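(* Let $a\in\mathbb C$, $b\in\mathbb C^\times$ and $j\in\mathbb Z$. The graded subspaces of $\mathcal{SD}^{\sigma_{a,b}}$ of degrees $j$ and $j-\frac12$ are $$\mathcal{SD}^{\sigma_{a,b}}_j=\{\partial_\theta\theta\, t^jf(D+(j-a-1)/2)+\theta\partial_\theta\, t^jg(D+(j-a)/2)\mid f,g\in\mathbb C^{(\overline j)}[w]\},$$ $$\mathcal{SD}^{\sigma_{a,b}}_{j-1/2}=\{\theta\, t^{j-1}g_0(D)+\partial_\theta\,(-t)^j\,b\,g_0(-D-j+a+1)\mid g_0\in\mathbb C[w]\}.$$
   Context: $\mathcal{SD}$ is the Lie superalgebra (supercommutator bracket) of the associative superalgebra over $\mathbb C$ generated by even $t^{\pm1}$, $D=t\frac{d}{dt}$ and odd $\theta,\partial_\theta$, with $f(D)t=tf(D+1)$, $\theta^2=\partial_\theta^2=0$, $\theta\partial_\theta+\partial_\theta\theta=1$, $\theta,\partial_\theta$ commuting with $t,D$. It has basis $t^kD^l$ ($k\in\mathbb Z,l\ge0$) times $\theta\partial_\theta,\partial_\theta\theta,\theta,\partial_\theta$. It is $\frac12\mathbb Z$-graded (principal gradation) by $wt(t)=1$, $wt(D)=0$, $wt(\theta)=\frac12$, $wt(\partial_\theta)=-\frac12$. The anti-involution $\sigma_{a,b}$ is the $\mathbb C$-linear map with $\sigma(XY)=(-1)^{|X||Y|}\sigma(Y)\sigma(X)$ determined by $\sigma_{a,b}(t)=-t$, $\sigma_{a,b}(D)=-D+a+\partial_\theta\theta$, $\sigma_{a,b}(\theta)=bt\partial_\theta$,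 $\sigma_{a,b}(\partial_\theta)=-(bt)^{-1}\theta$. For an anti-involution $\sigma$ put $\mathcal{SD}^\sigma=\{e\in\mathcal{SD}\mid\sigma(e)=-e\}$, graded by the principal gradation. $\mathbb C^{(0)}[w]$ (resp. $\mathbb C^{(1)}[w]$) is the space of even (resp. odd) polynomials in $w$; $\overline k=0$ if $k$ is odd and $\overline k=1$ if $k$ is even. *)

(* Defs.v *)
From HB Require Import structures.
From mathcomp Require Import all_boot all_order all_algebra.
From mathcomp Require Import finmap.
From mathcomp Require Import boolp classical_sets reals.
From mathcomp Require Import complex ring.
From mathcomp.multinomials Require Import monalg.

Set Implicit Arguments.
Unset Strict Implicit.
Unset Printing Implicit Defensive.

Import Order.TTheory GRing.Theory Num.Theory.

Local Open Scope ring_scope.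

(* The associative algebra F[t, t^-1, D] with f(D) t = t f(D + 1).  The        *)
(* element \sum_k t^k f_k(D) is represented by the finitely supported family  *)
(* of polynomials k |-> f_k.                                                  *)
Definition diffop (F : fieldType) : Type := {malg {poly F}[int]}.

HB.instance Definition _ (F : fieldType) := GRing.Zmodule.on (diffop F).

(* t^k f(D) *)
HB.lock Definition dmono (F : fieldType) (k : int) (f : {poly F}) : diffop F :=
  << f *g k >>.

(* f(w + k) *)
Definition shiftp (F : fieldType) (k : int) (f : {poly F}) : {poly F} :=
  f \Po ('X + k%:~R%:P).

(* (t^k f(D)) (t^m g(D)) = t^(k+m) f(D + m) g(D) *)
HB.lock Definition diffop_mul (F : fieldType) (u v : diffop F) : diffop F :=
  \sum_(k <- msupp u) \sum_(m <- msupp v)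
    dmono (k + m) (shiftp m u@_k * v@_m).

HB.lock Definition diffop_scale (F : fieldType) (c : F) (u : diffop F) :
    diffop F :=
  \sum_(k <- msupp u) dmono k (c *: u@_k).

Section DiffopRing.
Variable F : fieldType.
Implicit Types (f g : {poly F}) (k m : int) (u v w : diffop F) (c d : F).

Lemma dmono_coef k f m : (dmono k f)@_m = f *+ (k == m).
Proof. by rewrite unlock mcoeffU. Qed.

Lemma dmonoD k : {morph @dmono F k : f g / f + g}.
Proof. by move=> f g; rewrite unlock monalgUD. Qed.

Lemma dmono0 k : dmono k (0 : {poly F}) = 0.
Proof. by rewrite unlock monalgU0. Qed.

HB.instance Definition _ k := GRing.isSemiAdditive.Build
  {poly F} (diffop F) (@dmono F k) (dmono0 k, dmonoD k).

Definition diffop_ext (V : zmodType) (G : int -> {poly F} -> V) u : V :=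
  \sum_(k <- msupp u) G k u@_k.

Lemma diffop_extw (V : zmodType) (G : int -> {poly F} -> V)
    (d : {fset int}) u :
  (forall k, G k 0 = 0) -> (msupp u `<=` d)%fset ->
  diffop_ext G u = \sum_(k <- d) G k u@_k.
Proof.
move=> G0 le; rewrite /diffop_ext; apply/big_fset_incl => // k _ kN.
by rewrite mcoeff_outdom.
Qed.

Lemma diffop_extD (V : zmodType) (G : int -> {poly F} -> V) :
  (forall k, {morph G k : f g / f + g}) ->
  {morph diffop_ext G : u v / u + v}.
Proof.
move=> GD u v.
have G0 k : G k 0 = 0 by apply: (addrI (G k 0)); rewrite -GD !addr0.
pose d := (msupp u `|` msupp v)%fset.
have leD : (msupp (u + v) `<=` d)%fset by exact: msuppD_le.
have leu : (msupp u `<=` d)%fset by exact: fsubsetUl.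
have lev : (msupp v `<=` d)%fset by exact: fsubsetUr.
rewrite (diffop_extw G0 leD) (diffop_extw G0 leu) (diffop_extw G0 lev).
by rewrite -big_split /=; apply: eq_bigr => k _; rewrite mcoeffD GD.
Qed.

Lemma diffop_extU (V : zmodType) (G : int -> {poly F} -> V) k f :
  (forall k, {morph G k : f g / f + g}) ->
  diffop_ext G (dmono k f) = G k f.
Proof.
move=> GD.
have G0 i : G i 0 = 0 by apply: (addrI (G i 0)); rewrite -GD !addr0.
rewrite (@diffop_extw _ _ [fset k]%fset) //; last by rewrite unlock msuppU_le.
by rewrite big_seq_fset1 dmono_coef eqxx.
Qed.

Lemma diffop_sum u : u = \sum_(k <- msupp u) dmono k u@_k.
Proof. by rewrite {1}[u]monalgE; apply: eq_bigr => k _; rewrite unlock. Qed.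

Lemma diffop_ind (P : diffop F -> Prop) :
  P 0 -> (forall u v, P u -> P v -> P (u + v)) ->
  (forall k f, P (dmono k f)) -> forall u, P u.
Proof.
move=> P0 PD PU u; rewrite [u]diffop_sum.
by elim/big_ind: _ => // k _; apply: PU.
Qed.

Definition diffop_one : diffop F := dmono 0 1.

Lemma shiftpD k : {morph @shiftp F k : f g / f + g}.
Proof. by move=> f g; rewrite /shiftp raddfD. Qed.

Lemma shiftpM k : {morph @shiftp F k : f g / f * g}.
Proof. by move=> f g; rewrite /shiftp comp_polyM. Qed.

Lemma shiftp1 k : shiftp k 1 = 1 :> {poly F}.
Proof. by rewrite /shiftp comp_polyC. Qed.

Lemma shiftp0 f : shiftp 0 f = f.
Proof. by rewrite /shiftp mulr0z addr0 comp_polyXr. Qed.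

Lemma shiftp_shiftp k m f : shiftp k (shiftp m f) = shiftp (k + m) f.
Proof.
rewrite /shiftp -comp_polyA; congr (_ \Po _).
by rewrite comp_polyD comp_polyX comp_polyC intrD polyCD addrA.
Qed.

Lemma shiftpZ k c f : shiftp k (c *: f) = c *: shiftp k f.
Proof. by rewrite /shiftp comp_polyZ. Qed.

Lemma diffop_mulEl u v :
  diffop_mul u v = diffop_ext (fun k f =>
    diffop_ext (fun m g => dmono (k + m) (shiftp m f * g)) v) u.
Proof. by rewrite [diffop_mul]unlock. Qed.

Lemma diffop_scaleE c u :
  diffop_scale c u = diffop_ext (fun k f => dmono k (c *: f)) u.
Proof. by rewrite [diffop_scale]unlock. Qed.

Let mulG_D k f m : {morph (fun g => dmono (k + m) (shiftp m f * g)) :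
  g h / g + h}.
Proof. by move=> g h; rewrite mulrDr dmonoD. Qed.

Let mulG_Dl v k : {morph (fun f =>
    diffop_ext (fun m g => dmono (k + m) (shiftp m f * g)) v) :
  g h / g + h}.
Proof.
move=> g h; rewrite /diffop_ext -big_split /=; apply: eq_bigr => m _.
by rewrite shiftpD mulrDl dmonoD.
Qed.

Fact diffop_mulDl : left_distributive (@diffop_mul F) +%R.
Proof. by move=> u v w; rewrite !diffop_mulEl diffop_extD. Qed.

Fact diffop_mulDr : right_distributive (@diffop_mul F) +%R.
Proof.
move=> u v w; rewrite !diffop_mulEl /diffop_ext -big_split /=.
by apply: eq_bigr => k _; exact: (diffop_extD (mulG_D k _)).
Qed.

Let diffop_mul0l u : diffop_mul 0 u = 0.
Proof. by apply: (addrI (diffop_mul 0 u)); rewrite -diffop_mulDl !addr0. Qed.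

Let diffop_mul0r u : diffop_mul u 0 = 0.
Proof. by apply: (addrI (diffop_mul u 0)); rewrite -diffop_mulDr !addr0. Qed.

Fact diffop_mulUU k m f g :
  diffop_mul (dmono k f) (dmono m g) = dmono (k + m) (shiftp m f * g).
Proof. by rewrite diffop_mulEl diffop_extU // diffop_extU. Qed.

Fact diffop_mulA : associative (@diffop_mul F).
Proof.
elim/diffop_ind => [||k f] v w; first by rewrite !diffop_mul0l.
  by move=> Hv Hw x y; rewrite !diffop_mulDl Hv Hw.
move: v w; elim/diffop_ind => [||m g] w.
- by rewrite diffop_mul0r !diffop_mul0l diffop_mul0r.
- move=> v Hw Hv x.
  by rewrite diffop_mulDr !diffop_mulDl diffop_mulDr Hw Hv.
elim/diffop_ind: w => [|v w Hv Hw|n h]; first by rewrite !diffop_mul0r.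
  by rewrite !diffop_mulDr Hv Hw.
rewrite !diffop_mulUU shiftpM shiftp_shiftp mulrA addrA.
by rewrite [n + m]addrC.
Qed.

Fact diffop_mul1 : left_id diffop_one (@diffop_mul F).
Proof.
elim/diffop_ind => [|u v Hu Hv|k f]; first exact: diffop_mul0r.
  by rewrite diffop_mulDr Hu Hv.
by rewrite diffop_mulUU shiftp1 mul1r add0r.
Qed.

Fact diffop_mulr1 : right_id diffop_one (@diffop_mul F).
Proof.
elim/diffop_ind => [|u v Hu Hv|k f]; first exact: diffop_mul0l.
  by rewrite diffop_mulDl Hu Hv.
by rewrite diffop_mulUU shiftp0 mulr1 addr0.
Qed.

Fact diffop_one_neq0 : diffop_one != 0.
Proof. by rewrite /diffop_one unlock monalgU_eq0 oner_eq0. Qed.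

HB.instance Definition _ := GRing.Zmodule_isNzRing.Build (diffop F)
  diffop_mulA diffop_mul1 diffop_mulr1 diffop_mulDl diffop_mulDr
  diffop_one_neq0.

Let scaleG_D c k :
  {morph (fun f => dmono k (c *: f)) : f g / f + g}.
Proof. by move=> f g; rewrite scalerDr dmonoD. Qed.

Let diffop_scaleDr c : {morph @diffop_scale F c : u v / u + v}.
Proof. by move=> u v; rewrite !diffop_scaleE (diffop_extD (scaleG_D c)). Qed.

Let diffop_scale0 c : diffop_scale c (0 : diffop F) = 0.
Proof. by apply: (addrI (diffop_scale c 0)); rewrite -diffop_scaleDr !addr0. Qed.

Fact diffop_scaleU c k f : diffop_scale c (dmono k f) = dmono k (c *: f).
Proof. by rewrite diffop_scaleE (diffop_extU _ _ (scaleG_D c)). Qed.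

Fact diffop_scaleA c d u :
  diffop_scale c (diffop_scale d u) = diffop_scale (c * d) u.
Proof.
elim/diffop_ind: u => [|u v Hu Hv|k f]; first by rewrite !diffop_scale0.
  by rewrite !diffop_scaleDr Hu Hv.
by rewrite !diffop_scaleU scalerA.
Qed.

Fact diffop_scale1 : left_id 1 (@diffop_scale F).
Proof.
elim/diffop_ind => [|u v Hu Hv|k f]; first by rewrite !diffop_scale0.
  by rewrite !diffop_scaleDr Hu Hv.
by rewrite !diffop_scaleU scale1r.
Qed.

Fact diffop_scaleDl u : {morph (@diffop_scale F)^~ u : c d / c + d}.
Proof.
move=> c d /=; elim/diffop_ind: u => [|u v Hu Hv|k f].
- by rewrite !diffop_scale0 addr0.
- by rewrite !diffop_scaleDr Hu Hv addrACA.
by rewrite !diffop_scaleU scalerDl dmonoD.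
Qed.

HB.instance Definition _ := GRing.Zmodule_isLmodule.Build F (diffop F)
  diffop_scaleA diffop_scale1 diffop_scaleDr diffop_scaleDl.

Lemma diffopMUU k m f g :
  dmono k f * dmono m g = dmono (k + m) (shiftp m f * g).
Proof. exact: diffop_mulUU. Qed.

Lemma diffopZU c k f : c *: dmono k f = dmono k (c *: f).
Proof. exact: diffop_scaleU. Qed.

Fact diffop_scaleAl (c : F) u v : c *: (u * v) = c *: u * v.
Proof.
elim/diffop_ind: u v => [|u w Hu Hw|k f] v.
- by rewrite scaler0 !mul0r scaler0.
- by rewrite mulrDl !scalerDr Hu Hw mulrDl.
elim/diffop_ind: v => [|u w Hu Hw|m g].
- by rewrite !mulr0 scaler0.
- by rewrite !mulrDr scalerDr Hu Hw.
by rewrite diffopZU !diffopMUU diffopZU shiftpZ scalerAl.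
Qed.

HB.instance Definition _ :=
  GRing.Lmodule_isLalgebra.Build F (diffop F) diffop_scaleAl.

Fact diffop_scaleAr (c : F) u v : c *: (u * v) = u * (c *: v).
Proof.
elim/diffop_ind: u v => [|u w Hu Hw|k f] v.
- by rewrite !mul0r scaler0.
- by rewrite !mulrDl !scalerDr Hu Hw.
elim/diffop_ind: v => [|u w Hu Hw|m g].
- by rewrite scaler0 !mulr0 scaler0.
- by rewrite !mulrDr !scalerDr !mulrDr Hu Hw.
by rewrite !diffopZU !diffopMUU diffopZU scalerAr.
Qed.

HB.instance Definition _ :=
  GRing.Lalgebra_isAlgebra.Build F (diffop F) diffop_scaleAr.

End DiffopRing.

(* The matrix X : SD F acts on F[t, t^-1] (+) theta F[t, t^-1]; its blocks in *)
(* the basis (1, theta) are the components                                    *)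
(*   X 0 0 on d_theta theta,   X 0 1 on d_theta,                              *)
(*   X 1 0 on theta,           X 1 1 on theta d_theta.                        *)
Definition SD (F : fieldType) : Type := 'M[diffop F]_2.

HB.instance Definition _ (F : fieldType) := GRing.NzRing.on (SD F).

Section SDAlgebra.
Variable F : fieldType.
Implicit Types (X Y Z : SD F) (c : F).

Definition SD_scale c X : SD F := map_mx (fun u : diffop F => c *: u) X.

Fact SD_scaleA c d X : SD_scale c (SD_scale d X) = SD_scale (c * d) X.
Proof. by apply/matrixP => i j; rewrite !mxE scalerA. Qed.

Fact SD_scale1 : left_id 1 SD_scale.
Proof. by move=> X; apply/matrixP => i j; rewrite !mxE scale1r. Qed.

Fact SD_scaleDr : right_distributive SD_scale +%R.
Proof. by move=> c X Y; apply/matrixP => i j; rewrite !mxE scalerDr. Qed.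

Fact SD_scaleDl X : {morph SD_scale^~ X : c d / c + d}.
Proof. by move=> c d; apply/matrixP => i j; rewrite !mxE scalerDl. Qed.

HB.instance Definition _ := GRing.Zmodule_isLmodule.Build F (SD F)
  SD_scaleA SD_scale1 SD_scaleDr SD_scaleDl.

Fact SD_scaleAl c X Y : c *: (X * Y) = c *: X * Y.
Proof.
apply/matrixP => i j; rewrite !mxE scaler_sumr.
by apply: eq_bigr => k _; rewrite !mxE scalerAl.
Qed.

HB.instance Definition _ :=
  GRing.Lmodule_isLalgebra.Build F (SD F) SD_scaleAl.

Fact SD_scaleAr c X Y : c *: (X * Y) = X * (c *: Y).
Proof.
apply/matrixP => i j; rewrite !mxE scaler_sumr.
by apply: eq_bigr => k _; rewrite !mxE scalerAr.
Qed.

HB.instance Definition _ :=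
  GRing.Lalgebra_isAlgebra.Build F (SD F) SD_scaleAr.

Definition SD_unit : pred (SD F) :=
  fun X => `[< exists Y, Y * X = 1 /\ X * Y = 1 >].

Definition SD_inv X : SD F :=
  if pselect (exists Y, Y * X = 1 /\ X * Y = 1) is left h
  then projT1 (cid h) else X.

Fact SD_mulVr : {in SD_unit, left_inverse 1 SD_inv *%R}.
Proof.
move=> X /asboolP h; rewrite /SD_inv; case: pselect => // h'.
by case: cid => Y [].
Qed.

Fact SD_divrr : {in SD_unit, right_inverse 1 SD_inv *%R}.
Proof.
move=> X /asboolP h; rewrite /SD_inv; case: pselect => // h'.
by case: cid => Y [].
Qed.

Fact SD_unitP X Y : Y * X = 1 /\ X * Y = 1 -> SD_unit X.
Proof. by move=> h; apply/asboolP; exists Y. Qed.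

Fact SD_invr_out : {in [predC SD_unit], SD_inv =1 id}.
Proof.
move=> X /asboolPn h; rewrite /SD_inv; case: pselect => // h'.
Qed.

HB.instance Definition _ := GRing.NzRing_hasMulInverse.Build (SD F)
  SD_mulVr SD_divrr SD_unitP SD_invr_out.

Definition SDt : SD F := (dmono 1 1)%:M.
Definition SDD : SD F := (dmono 0 'X)%:M.
Definition SDtheta : SD F := delta_mx 1 0.
Definition SDdtheta : SD F := delta_mx 0 1.

End SDAlgebra.

Arguments SDt {F}.
Arguments SDD {F}.
Arguments SDtheta {F}.
Arguments SDdtheta {F}.


Section SDPresentation.
Variable F : fieldType.
Implicit Types (X Y Z : SD F) (c : F).

Local Notation t := (@SDt F).
Local Notation D := (@SDD F).
Local Notation theta := (@SDtheta F).
Local Notation dtheta := (@SDdtheta F).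
Local Notation "f %:SD" := ((dmono 0 f)%:M : SD F)
  (at level 2, left associativity).

Lemma SD_mulE X Y i j :
  (X * Y) i j = X i 0 * Y 0 j + X i 1 * Y 1 j.
Proof.
rewrite -[X * Y]/(X *m Y) mxE !big_ord_recl big_ord0 addr0.
by congr (_ * _ + X i _ * Y _ j); apply/val_inj.
Qed.

Lemma ord2_ind (P : 'I_2 -> Prop) : P 0 -> P 1 -> forall i, P i.
Proof.
move=> P0 P1 [[|[|?]] h] //.
  by have -> : Ordinal h = 0 by exact/val_inj.
by have -> : Ordinal h = 1 by exact/val_inj.
Qed.

Lemma SD_scalarM (u v : diffop F) :
  (u%:M : SD F) * v%:M = (u * v)%:M.
Proof. by rewrite -[LHS]/(u%:M *m v%:M) -scalar_mxM. Qed.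

Lemma SD_scalarZ c (u : diffop F) : c *: (u%:M : SD F) = (c *: u)%:M.
Proof. by apply/matrixP => i j; rewrite !mxE -scalerMnr. Qed.

Lemma SD1E : (1 : SD F) = (dmono 0 1)%:M.
Proof. by []. Qed.

Let tV : SD F := (dmono (-1) 1)%:M.

Let mulVt : tV * t = 1.
Proof. by rewrite SD_scalarM diffopMUU shiftp1 mulr1 addNr SD1E. Qed.

Let multV : t * tV = 1.
Proof. by rewrite SD_scalarM diffopMUU shiftp1 mulr1 addrN SD1E. Qed.

Lemma SDt_unit : t \is a GRing.unit.
Proof. by apply/unitrP; exists tV; split; [exact: mulVt | exact: multV]. Qed.

Lemma SDtVE : t^-1 = (dmono (-1) 1)%:M.
Proof. by rewrite -[t^-1]mulr1 -multV mulKr // SDt_unit. Qed.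

Lemma SDtzE (k : int) : t ^ k = (dmono k 1)%:M.
Proof.
case: k => n; rewrite /exprz ?NegzE.
  elim: n => [|n IHn]; first by rewrite expr0.
  by rewrite exprS IHn SD_scalarM diffopMUU shiftp1 mulr1 -intS.
rewrite -exprVn SDtVE; elim: n => [|n IHn]; first by rewrite expr1.
rewrite exprS IHn SD_scalarM diffopMUU shiftp1 mulr1.
by congr (dmono _ _)%:M; rewrite [in RHS]intS opprD.
Qed.

Lemma SDD_horner (f : {poly F}) : horner_alg D f = f%:SD.
Proof.
have fzE (u v : {poly F}) : dmono 0 u * dmono 0 v =
    dmono 0 (u * v).
  by rewrite diffopMUU shiftp0 addr0.
elim/poly_ind: f => [|f c IHf]; first by rewrite rmorph0 dmono0 raddf0.
rewrite rmorphD rmorphM /= horner_algX horner_algC IHf SD_scalarM fzE.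
rewrite dmonoD raddfD /=; congr (_ + _).
by rewrite SD1E SD_scalarZ diffopZU alg_polyC.
Qed.

Lemma SDmonomialE (k : int) (f : {poly F}) :
  t ^ k * horner_alg D f = (dmono k f)%:M.
Proof.
by rewrite SDD_horner SDtzE SD_scalarM diffopMUU shiftp1 mul1r addr0.
Qed.

Lemma SD_relDt (f : {poly F}) :
  horner_alg D f * t = t * horner_alg (D + 1) f.
Proof.
have -> : horner_alg (D + 1) f = horner_alg D (f \Po ('X + 1%:P)).
  elim/poly_ind: f => [|f c IHf]; first by rewrite comp_poly0 !rmorph0.
  rewrite comp_polyD comp_polyM comp_polyX comp_polyC !(rmorphD, rmorphM) /=.
  by rewrite !(rmorphD, horner_algX, horner_algC) /= scale1r IHf.
rewrite -(expr1z t) !SDD_horner !SDtzE !SD_scalarM !diffopMUU.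
by rewrite shiftp1 mulr1 mul1r addr0 add0r.
Qed.

Lemma SD_reltheta2 : theta * theta = 0.
Proof. by rewrite -[LHS]/(delta_mx 1 0 *m delta_mx 1 0) mul_delta_mx_0. Qed.

Lemma SD_reldtheta2 : dtheta * dtheta = 0.
Proof. by rewrite -[LHS]/(delta_mx 0 1 *m delta_mx 0 1) mul_delta_mx_0. Qed.

Lemma SD_relCAR : theta * dtheta + dtheta * theta = 1.
Proof.
rewrite -[LHS]/(delta_mx 1 0 *m delta_mx 0 1 + delta_mx 0 1 *m delta_mx 1 0).
rewrite !mul_delta_mx; apply/matrixP => i j; rewrite !mxE.
by case: i => [[|[|?]] ?] //; case: j => [[|[|?]] ?] //; rewrite ?addr0 ?add0r.
Qed.

Lemma SD_comm_delta (u : diffop F) i j :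
  GRing.comm (u%:M : SD F) (delta_mx i j).
Proof.
rewrite /GRing.comm -[LHS]/(u%:M *m delta_mx i j) -[RHS]/(delta_mx i j *m u%:M).
apply/matrixP => k l; rewrite mul_scalar_mx !mxE (bigD1 l) //= !mxE eqxx.
rewrite big1 => [|m /negPf ml]; last by rewrite !mxE ml mulr0.
by rewrite addr0 mulr1n -commr_nat.
Qed.

Lemma SD_relthetat : theta * t = t * theta.
Proof. exact/esym/SD_comm_delta. Qed.

Lemma SD_reldthetat : dtheta * t = t * dtheta.
Proof. exact/esym/SD_comm_delta. Qed.

Lemma SD_relthetaD : theta * D = D * theta.
Proof. exact/esym/SD_comm_delta. Qed.

Lemma SD_reldthetaD : dtheta * D = D * dtheta.
Proof. exact/esym/SD_comm_delta. Qed.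

(* SD_span and SD_free say that the SDmonomial i j k l form an F-basis.       *)
Definition SDfermion (i j : 'I_2) : SD F :=
  match val i, val j with
  | 0%N, 0%N => dtheta * theta
  | 0%N, _ => dtheta
  | _, 0%N => theta
  | _, _ => theta * dtheta
  end.

Definition SDmonomial (i j : 'I_2) (k : int) (l : nat) : SD F :=
  SDfermion i j * (t ^ k * D ^+ l).

Lemma SDfermionE i j : SDfermion i j = delta_mx i j.
Proof.
rewrite /SDfermion -[dtheta * theta]/(delta_mx 0 1 *m delta_mx 1 0).
rewrite -[theta * dtheta]/(delta_mx 1 0 *m delta_mx 0 1) !mul_delta_mx.
by case: i => [[|[|?]] ?] //; case: j => [[|[|?]] ?] //=; congr delta_mx; apply/val_inj.
Qed.

Lemma SD_scalar_delta (u : diffop F) i j i' j' :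
  (delta_mx i j * u%:M : SD F) i' j' = u *+ ((i == i') && (j == j')).
Proof.
rewrite -SD_comm_delta -[_ * _]/(u%:M *m delta_mx i j) mul_scalar_mx !mxE.
by rewrite mulr_natr ![_ == i']eq_sym ![_ == j']eq_sym.
Qed.

Lemma SDmonomialIE i j k l :
  SDmonomial i j k l = delta_mx i j * (dmono k ('X^l))%:M.
Proof.
rewrite /SDmonomial SDfermionE -SDmonomialE; congr (_ * (_ * _)).
by rewrite rmorphXn /= horner_algX.
Qed.

Lemma SD_span X :
  X = \sum_i \sum_j \sum_(k <- msupp (X i j))
        \sum_(l < size (X i j)@_k) ((X i j)@_k)`_l *: SDmonomial i j k l.
Proof.
have E i j k : \sum_(l < size (X i j)@_k) ((X i j)@_k)`_l *: SDmonomial i j k l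
    = delta_mx i j * (dmono k (X i j)@_k)%:M.
  rewrite -[in X in _ * X](coefK (X i j)@_k) poly_def.
  rewrite !raddf_sum mulr_sumr /=; apply: eq_bigr => l _.
  by rewrite SDmonomialIE -diffopZU -SD_scalarZ scalerAr.
have E2 i j : \sum_(k <- msupp (X i j))
        \sum_(l < size (X i j)@_k) ((X i j)@_k)`_l *: SDmonomial i j k l
    = delta_mx i j * (X i j)%:M.
  rewrite [in RHS](diffop_sum (X i j)) raddf_sum mulr_sumr.
  by apply: eq_bigr => k _; rewrite E.
apply/matrixP => i j; rewrite summxE (bigD1 i) //= summxE (bigD1 j) //=.
rewrite E2 SD_scalar_delta !eqxx mulr1n big1 ?addr0 => [|j' /negPf nj].
  rewrite big1 ?addr0 // => i' /negPf ni.
  by rewrite summxE big1 // => j' _; rewrite E2 SD_scalar_delta ni.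
by rewrite E2 SD_scalar_delta nj andbF.
Qed.

Lemma SD_free i j k l i' j' k' l' :
  ((SDmonomial i j k l i' j')@_k')`_l' =
  [&& i == i', j == j', k == k' & l == l']%:R.
Proof.
rewrite SDmonomialIE SD_scalar_delta.
case: (i == i'); case: (j == j'); rewrite ?mcoeff0 ?coef0 //=.
rewrite dmono_coef; case: (k == k'); rewrite ?coef0 //=.
by rewrite mulr1n coefXn eq_sym.
Qed.

End SDPresentation.

Inductive SDgen := gen_t | gen_tV | gen_D | gen_theta | gen_dtheta.

Definition SDgen_val (F : fieldType) (x : SDgen) : SD F :=
  match x with
  | gen_t => SDt
  | gen_tV => SDt^-1
  | gen_D => SDD
  | gen_theta => SDtheta
  | gen_dtheta => SDdtheta
  end.

(* graded wt g X: X is homogeneous of degree g for the algebra gradation in   *)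
(* which each generator x has degree wt x.                                    *)
Inductive graded (F : fieldType) (G : zmodType) (wt : SDgen -> G) :
    G -> SD F -> Prop :=
| graded0 g : graded wt g 0
| graded1 : graded wt 0 1
| graded_gen x : graded wt (wt x) (SDgen_val F x)
| gradedD g X Y : graded wt g X -> graded wt g Y -> graded wt g (X + Y)
| gradedZ g c X : graded wt g X -> graded wt g (c *: X)
| gradedM g h X Y :
    graded wt g X -> graded wt h Y -> graded wt (g + h) (X * Y).

(* Degrees in Z/2, realised as bool with addition addb.                       *)
Definition SDparity (x : SDgen) : bool :=
  match x with
  | gen_t | gen_tV | gen_D => false
  | gen_theta | gen_dtheta => true
  end.

Definition SDprincipal (x : SDgen) : rat :=
  match x with
  | gen_t => 1
  | gen_tV => -1
  | gen_D => 0
  | gen_theta => 1 / 2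
  | gen_dtheta => - (1 / 2)
  end.

Definition super_antimorphism (F : fieldType) (s : SD F -> SD F) : Prop :=
  forall (p q : bool) (X Y : SD F),
    graded SDparity p X -> graded SDparity q Y ->
    s (X * Y) = (-1) ^+ (p && q) *: (s Y * s X).

Record is_sigma (F : fieldType) (a b : F) (s : {linear SD F -> SD F}) : Prop :=
  IsSigma {
    sigma_anti : super_antimorphism s;
    sigma_t : s SDt = - SDt;
    sigma_D : s SDD = - SDD + a%:A + SDdtheta * SDtheta;
    sigma_theta : s SDtheta = b *: SDt * SDdtheta;
    sigma_dtheta : s SDdtheta = - (b *: SDt)^-1 * SDtheta
  }.

Definition SDsigma (F : fieldType) (s : SD F -> SD F) : set (SD F) :=
  [set e | s e = - e]%classic.

Definition SDsigma_deg (F : fieldType) (s : SD F -> SD F) (m : rat) :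
    set (SD F) :=
  (SDsigma s `&` [set e | graded SDprincipal m e])%classic.

(* Even (o = false) or odd (o = true) polynomials.                            *)
Definition poly_parity (F : fieldType) (o : bool) : set {poly F} :=
  [set f | f \Po (- 'X) = (-1) ^+ o *: f]%classic.

(* \overline k: 0 if k is odd, 1 if k is even.                                *)
Definition parity_bar (k : int) : bool := ~~ odd `|k|%N.

Section PrincipalGradation.
Variable F : fieldType.

Let homog (q : rat) (u : diffop F) : Prop :=
  u = 0 \/ exists k f, u = dmono k f /\ q = k%:~R.

Let homogD q u v : homog q u -> homog q v -> homog q (u + v).
Proof.
case=> [->|[k [f [-> qk]]]]; first by rewrite add0r.
case=> [->|[m [g [-> qm]]]]; first by rewrite addr0; right; exists k, f.
right; exists k, (f + g); split=> //.
have /eqP : k%:~R == m%:~R :> rat by rewrite -qk qm.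
by move=> /intr_inj <-; rewrite dmonoD.
Qed.

Let homogM q r u v : homog q u -> homog r v -> homog (q + r) (u * v).
Proof.
case=> [->|[k [f [-> ->]]]]; first by rewrite mul0r; left.
case=> [->|[m [g [-> ->]]]]; first by rewrite mulr0; left.
by right; exists (k + m), (shiftp m f * g); rewrite diffopMUU intrD.
Qed.

Lemma graded_principal (m : rat) (X : SD F) (i j : 'I_2) :
  graded SDprincipal m X ->
  X i j = 0 \/ exists k f, X i j = dmono k f /\
    m - ((i : nat)%:R - (j : nat)%:R) / 2 = k%:~R.
Proof.
rewrite -/(homog _ _) => h.
elim: h i j => {m X} [m||x|m X Y _ HX _ HY|m c X _ HX|m n X Y _ HX _ HY] i j.
- by left; rewrite mxE.
- rewrite SD1E mxE; have [->|_] := eqVneq i j; last by left.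
  by right; exists 0, 1; rewrite subrr mul0r subr0.
- have dE k l i' j' : (delta_mx k l : SD F) i' j' =
      dmono 0 1 *+ ((i' == k) && (j' == l)) by rewrite mxE.
  case: x; rewrite /= ?SDtVE ?dE ?mxE;
  elim/ord2_ind: i; elim/ord2_ind: j; try (by left);
  right; eexists; eexists; (split; [reflexivity | by []]).
- by rewrite mxE; apply: homogD.
- rewrite mxE; case: (HX i j) => [->|[k [f [-> ->]]]].
    by rewrite scaler0; left.
  by right; exists k, (c *: f); rewrite diffopZU.
suff H k : homog (m + n - ((i : nat)%:R - (j : nat)%:R) / 2) (X i k * Y k j).
  by rewrite SD_mulE; apply: homogD.
have -> : m + n - ((i : nat)%:R - (j : nat)%:R) / 2 =
  (m - ((i : nat)%:R - (k : nat)%:R) / 2) +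
  (n - ((k : nat)%:R - (j : nat)%:R) / 2) by ring.
exact: homogM.
Qed.

End PrincipalGradation.

Section SigmaExists.
Variable F : fieldType.
Implicit Types (f g : {poly F}) (k m s : int) (u v w : diffop F) (d c : F).

Let revp d k f : {poly F} := f \Po (- 'X + (d - k%:~R)%:P).

(* t^k f(D) |-> (-1)^k t^(k+s) f(-D-k+d) *)
Let tau s d : diffop F -> diffop F := diffop_ext
  (fun k f => dmono (k + s) ((-1) ^ k *: revp d k f) : diffop F).

Let tauG_D s d k :
  {morph (fun f => dmono (k + s) ((-1) ^ k *: revp d k f)) :
    f g / f + g}.
Proof. by move=> f g; rewrite /revp raddfD scalerDr dmonoD. Qed.

Let tauD s d : {morph tau s d : u v / u + v}.
Proof. exact: diffop_extD (tauG_D s d). Qed.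

Let tauU s d k f :
  tau s d (dmono k f) = dmono (k + s) ((-1) ^ k *: revp d k f).
Proof. exact: (diffop_extU _ _ (tauG_D s d)). Qed.

Let tau0 s d : tau s d 0 = 0.
Proof. by apply: (addrI (tau s d 0)); rewrite -tauD !addr0. Qed.

Let tauZ s d c u : tau s d (c *: u) = c *: tau s d u.
Proof.
elim/diffop_ind: u => [|u v Hu Hv|k f]; first by rewrite scaler0 tau0 scaler0.
  by rewrite scalerDr !tauD scalerDr Hu Hv.
by rewrite diffopZU !tauU diffopZU /revp comp_polyZ !scalerA mulrC.
Qed.

Let tauM s1 s2 d u v :
  tau (s1 + s2) d (u * v) = tau s2 (d + s1%:~R) v * tau s1 d u.
Proof.
elim/diffop_ind: u v => [|u w Hu Hw|k f] v.
- by rewrite mul0r !tau0 mulr0.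
- by rewrite mulrDl !tauD mulrDr Hu Hw.
elim/diffop_ind: v => [|u w Hu Hw|m g].
- by rewrite mulr0 !tau0 mul0r.
- by rewrite mulrDr !tauD mulrDl Hu Hw.
rewrite diffopMUU !tauU diffopMUU.
have -> : m + s2 + (k + s1) = k + m + (s1 + s2) by ring.
congr (dmono _ _).
rewrite shiftpZ -scalerAl -scalerAr scalerA -expfzDr ?oppr_eq0 ?oner_eq0 //.
rewrite [m + k]addrC; congr (_ *: _).
rewrite /revp /shiftp comp_polyM mulrC -!comp_polyA; congr ((_ \Po _) * (_ \Po _)).
- rewrite comp_polyD comp_polyC raddfN /= comp_polyX; ring.
- rewrite comp_polyD comp_polyC comp_polyX; ring.
Qed.

Let tau1U s d k : tau s d (dmono k 1) = dmono (k + s) (((-1) ^ k)%:P).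
Proof. by rewrite tauU /revp comp_polyC alg_polyC. Qed.

Variables a b : F.

Definition SDsigma_map (X : SD F) : SD F := \matrix_(i, j)
  match val i, val j with
  | 0%N, 0%N => tau 0 (a + 1) (X 0 0)
  | 0%N, _ => b *: tau 1 a (X 1 0)
  | _, 0%N => - b^-1 *: tau (-1) (a + 1) (X 0 1)
  | _, _ => tau 0 a (X 1 1)
  end.

Fact SDsigma_map_linear : linear SDsigma_map.
Proof.
move=> c X Y; apply/matrixP => i j; rewrite !mxE.
case: i => [[|[|?]] ?] //; case: j => [[|[|?]] ?] //=;
  rewrite ?mxE !tauD !tauZ //= ?scalerDr ?scalerA //.
  by rewrite mulrC.
by rewrite mulrC.
Qed.

HB.instance Definition _ :=
  GRing.isLinear.Build F (SD F) (SD F) *:%R SDsigma_map SDsigma_map_linear.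

Lemma graded_parity (p : bool) (X : SD F) (i j : 'I_2) :
  graded SDparity p X -> (i != j) != p -> X i j = 0.
Proof.
move=> h; elim: h i j => {p X} [p||x|p X Y _ HX _ HY|p c X _ HX|p q X Y _ HX _ HY] i j.
- by rewrite mxE.
- by rewrite SD1E mxE; case: (i == j).
- by case: x; rewrite /= ?SDtVE ?mxE; elim/ord2_ind: i; elim/ord2_ind: j.
- by move=> h; rewrite mxE HX ?HY ?addr0.
- by move=> h; rewrite mxE HX // scaler0.
rewrite SD_mulE -[p + q]/(addb p q); move: HX HY; case: p; case: q => HX HY;
elim/ord2_ind: i; elim/ord2_ind: j => // _; first [
  by rewrite (HX _ 0) // (HX _ 1) // !mul0r addr0
| by rewrite (HX _ 0) // (HY 1) // mulr0 mul0r addr0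
| by rewrite (HX _ 1) // (HY 0) // mulr0 mul0r addr0].
Qed.

Hypothesis b_neq0 : b != 0.

Lemma SDsigma_map_anti : super_antimorphism SDsigma_map.
Proof.
move=> p q X Y gX gY.
have T s1 s2 s d d' u v : s = s1 + s2 -> d' = d + s1%:~R ->
    tau s d (u * v) = tau s2 d' v * tau s1 d u by move=> -> ->; exact: tauM.
have H00 d u v : tau 0 d (u * v) = tau 0 d v * tau 0 d u.
  by apply: T; rewrite // addr0.
have Hm1 u v : tau 0 (a + 1) (u * v) = tau 1 a v * tau (-1) (a + 1) u.
  by apply: T => //; ring.
have H1m u v : tau 0 a (u * v) = tau (-1) (a + 1) v * tau 1 a u.
  by apply: T.
have H01 u v : tau 1 a (u * v) = tau 1 a v * tau 0 a u.
  by apply: T => //; rewrite addr0.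
have H10 u v : tau 1 a (u * v) = tau 0 (a + 1) v * tau 1 a u.
  by apply: T.
have H0m u v :
    tau (-1) (a + 1) (u * v) = tau (-1) (a + 1) v * tau 0 (a + 1) u.
  by apply: T => //; rewrite addr0.
have Hm0 u v : tau (-1) (a + 1) (u * v) = tau 0 a v * tau (-1) (a + 1) u.
  by apply: T => //; ring.
have pX (k l : 'I_2) (h : (k != l) != p) := graded_parity gX h.
have pY (k l : 'I_2) (h : (k != l) != q) := graded_parity gY h.
have bVb (u v : diffop F) : (b *: u) * (- b^-1 *: v) = - (u * v).
  by rewrite -scalerAl -scalerAr scalerA mulrN mulfV // scaleN1r.
have bbV (u v : diffop F) : (- b^-1 *: u) * (b *: v) = - (u * v).
  by rewrite -scalerAl -scalerAr scalerA mulNr mulVf // scaleN1r.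
have ZE c (Z : SD F) (k l : 'I_2) : (c *: Z) k l = c *: Z k l by rewrite mxE.
have sE (Z : SD F) (k l : 'I_2) : SDsigma_map Z k l = match val k, val l with
  | 0%N, 0%N => tau 0 (a + 1) (Z 0 0)
  | 0%N, _ => b *: tau 1 a (Z 1 0)
  | _, 0%N => - b^-1 *: tau (-1) (a + 1) (Z 0 1)
  | _, _ => tau 0 a (Z 1 1) end by rewrite mxE.
have zX : if p then X 0 0 = 0 /\ X 1 1 = 0 else X 0 1 = 0 /\ X 1 0 = 0.
  by case: (p) pX => pX; split; apply: pX.
have zY : if q then Y 0 0 = 0 /\ Y 1 1 = 0 else Y 0 1 = 0 /\ Y 1 0 = 0.
  by case: (q) pY => pY; split; apply: pY.
apply/matrixP => i j; rewrite ZE SD_mulE !sE /= !SD_mulE !tauD {sE ZE pX pY gX gY}.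
pose simp := (tau0, mul0r, mulr0, addr0, add0r, scaler0, oppr0, expr0, expr1,
  scale1r, scaleN1r).
elim/ord2_ind: i; elim/ord2_ind: j => /=.
- rewrite H00 Hm1 bVb.
  by case: (p) (q) zX zY => [] [] [z1 z2] [z3 z4] /=;
    rewrite ?z1 ?z2 ?z3 ?z4 !simp // ?opprK.
- rewrite H10 H01 -scalerAl -scalerAr.
  by case: (p) (q) zX zY => [] [] [z1 z2] [z3 z4] /=;
    rewrite ?z1 ?z2 ?z3 ?z4 !simp.
- rewrite H0m Hm0 -scalerAl -scalerAr.
  by case: (p) (q) zX zY => [] [] [z1 z2] [z3 z4] /=;
    rewrite ?z1 ?z2 ?z3 ?z4 !simp.
rewrite H1m H00 bbV.
by case: (p) (q) zX zY => [] [] [z1 z2] [z3 z4] /=;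
    rewrite ?z1 ?z2 ?z3 ?z4 !simp // ?opprK.
Qed.

Lemma dmono1 : dmono 0 1 = 1 :> diffop F.
Proof. by []. Qed.

Lemma SDsigma_map_sigma : is_sigma a b SDsigma_map.
Proof.
have sE (Z : SD F) (k l : 'I_2) : SDsigma_map Z k l = match val k, val l with
  | 0%N, 0%N => tau 0 (a + 1) (Z 0 0)
  | 0%N, _ => b *: tau 1 a (Z 1 0)
  | _, 0%N => - b^-1 *: tau (-1) (a + 1) (Z 0 1)
  | _, _ => tau 0 a (Z 1 1) end by rewrite mxE.
have scE (u : diffop F) (k l : 'I_2) : (u%:M : SD F) k l = u *+ (k == l).
  by rewrite mxE.
have dE (k l k' l' : 'I_2) : (delta_mx k l : SD F) k' l' =
    dmono 0 ((k' == k) && (l' == l))%:R.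
  by rewrite mxE; case: andb; rewrite ?dmono1 // dmono0.
have ZE c (Z : SD F) (k l : 'I_2) : (c *: Z) k l = c *: Z k l by rewrite mxE.
have DE (Z Z' : SD F) (k l : 'I_2) : (Z + Z') k l = Z k l + Z' k l.
  by rewrite mxE.
have NE (Z : SD F) (k l : 'I_2) : (- Z) k l = - Z k l by rewrite mxE.
split; first exact: SDsigma_map_anti.
- apply/matrixP => i j; rewrite sE NE !scE.
  elim/ord2_ind: i; elim/ord2_ind: j => /=;
  by rewrite ?(tau0, scaler0, oppr0) // tau1U addr0 expr1z polyCN raddfN.
- have -> : SDdtheta * SDtheta = delta_mx 0 0 :> SD F.
    by rewrite -[LHS]/(delta_mx 0 1 *m delta_mx 1 0) mul_delta_mx.
  apply/matrixP => i j; rewrite sE !DE NE ZE dE SD1E !scE.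
  elim/ord2_ind: i; elim/ord2_ind: j => /=;
  rewrite ?(tau0, scaler0, oppr0, addr0, dmono0) // tauU /revp mulr0z subr0 expr0z scale1r.
    rewrite comp_polyX ?subr0 ?addr0 polyCD addrA !dmonoD raddfN /=.
    by rewrite -(alg_polyC a) -diffopZU.
  by rewrite comp_polyX ?subr0 ?addr0 !dmonoD raddfN /= -(alg_polyC a) -diffopZU.
- apply/matrixP => i j; rewrite sE !dE -scalerAl ZE SD_comm_delta.
  rewrite SD_scalar_delta.
  elim/ord2_ind: i; elim/ord2_ind: j => /=;
  rewrite ?(tau0, scaler0, dmono0) // tau1U expr0z add0r //.
- rewrite invrZ ?unitfE // ?SDt_unit // SDtVE mulNr -scalerAl.
  rewrite SD_comm_delta.
  apply/matrixP => i j; rewrite sE !dE NE ZE SD_scalar_delta.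
  elim/ord2_ind: i; elim/ord2_ind: j => /=;
  by rewrite ?(tau0, scaler0, dmono0, oppr0) // tau1U expr0z add0r scaleNr.
Qed.

Theorem sigma_exists : {s : {linear SD F -> SD F} | is_sigma a b s}.
Proof. by exists SDsigma_map; exact: SDsigma_map_sigma. Qed.

End SigmaExists.

(* Main.v *)
Require Import Defs.
From mathcomp Require Import all_boot all_order all_algebra.
From mathcomp Require Import boolp classical_sets reals.
From mathcomp Require Import complex ring zify.

(** Write E_ij for the four fermionic products: dtheta theta, dtheta, theta
    and theta dtheta are E_00, E_01, E_10 and E_11.  Every element of SD is a
    sum of blocks E_ij t^k f(D), the block having principal degree
    k + (i - j) / 2.  Hence an element of integral degree j is
    E_00 t^j f(D) + E_11 t^j g(D), and one of degree j - 1/2 is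
    E_10 t^(j-1) f(D) + E_01 t^j g(D) ([graded_principal_intP],
    [graded_principal_halfP]).

    An anti-involution sigma sends E_ij t^k f(D) to
    f(sigma D) (-t)^k sigma(E_ij), without sign since t and D are even.  The
    image sigma(E_ij) is a multiple of some E_i'j' t^m, on the left of which
    sigma(D) = - D + a + E_00 acts as the scalar operator
    - D + a + (i' == 0).  Moving the polynomial to the right of t^(k+m) shifts
    its argument, so sigma maps blocks to blocks and reflects f about a point
    ([sigma_block_gen]):
    - E_00 and E_11 are fixed, with f(w) replaced by (-1)^k f(a + 1 - k - w),
      resp. (-1)^k f(a - k - w).  After translating w so that the centre of
      reflection becomes the origin, sigma(e) = - e is the parity condition
      on the two polynomials ([reflp_parity]).
    - E_10 and E_01 are exchanged, so the E_10 block can be chosen freely and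
      the equation on E_01 blocks determines the other one.  The equation on
      E_10 blocks then holds because the reflection is an involution
      ([SDsigma_oddP]). *)

Set Implicit Arguments.
Unset Strict Implicit.

Import Order.TTheory GRing.Theory Num.Theory.
Local Open Scope ring_scope.
Local Open Scope classical_set_scope.

(** * Blocks E_ij t^k f(D) *)

Section Blocks.
Context {F : fieldType}.
Implicit Types (f g : {poly F}) (k m : int) (c : F).

Definition SDblock (i j : 'I_2) k f : SD F := delta_mx i j * (dmono k f)%:M.

Lemma SDblockE i j k f i' j' :
  SDblock i j k f i' j' = dmono k f *+ ((i == i') && (j == j')).
Proof. exact: SD_scalar_delta. Qed.

Lemma SDblockD i j k f g :
  SDblock i j k (f + g) = SDblock i j k f + SDblock i j k g.
Proof. by rewrite /SDblock dmonoD raddfD mulrDr. Qed.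

Lemma SDblockN i j k f : SDblock i j k (- f) = - SDblock i j k f.
Proof. by rewrite /SDblock !raddfN mulrN. Qed.

Lemma SDblockZ i j k c f : SDblock i j k (c *: f) = c *: SDblock i j k f.
Proof. by rewrite /SDblock scalerAr SD_scalarZ diffopZU. Qed.

Lemma SDblock1 i j : SDblock i j 0 1 = delta_mx i j.
Proof. by rewrite /SDblock -SD1E mulr1. Qed.

Lemma SDblock0 i j k : SDblock i j k 0 = 0.
Proof. by rewrite /SDblock dmono0 raddf0 mulr0. Qed.

Lemma dmono_inj k : injective (@dmono F k).
Proof.
move=> f g /(congr1 (fun u : diffop F => monalg.mcoeff k u)).
by rewrite !dmono_coef eqxx !mulr1n.
Qed.

Lemma SDblock_pair_inj i j i' j' k m f g f' g' : (i, j) != (i', j') ->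
  SDblock i j k f + SDblock i' j' m g = SDblock i j k f' + SDblock i' j' m g' ->
  f = f' /\ g = g'.
Proof.
rewrite xpair_eqE => /negPf ne /matrixP H; split.
  have := H i j; rewrite mxE [in RHS]mxE !SDblockE !eqxx.
  by rewrite (eq_sym i' i) (eq_sym j' j) ne !addr0; exact: dmono_inj.
have := H i' j'; rewrite mxE [in RHS]mxE !SDblockE !eqxx ne !add0r.
exact: dmono_inj.
Qed.

Lemma SDblock_mulr i j k f m g :
  SDblock i j k f * (dmono m g)%:M = SDblock i j (k + m) (shiftp m f * g).
Proof. by rewrite /SDblock -mulrA SD_scalarM diffopMUU. Qed.

Lemma SDblockM i j l k m f g :
  SDblock i j k f * SDblock j l m g = SDblock i l (k + m) (shiftp m f * g).
Proof.
rewrite [SDblock j l m g]/SDblock mulrA -[_ * delta_mx j l]mulrA.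
rewrite SD_comm_delta mulrA.
rewrite -[delta_mx i j * delta_mx j l]/(delta_mx i j *m delta_mx j l).
by rewrite mul_delta_mx; exact: SDblock_mulr.
Qed.

End Blocks.

(** * Reflections of polynomials, and parity *)

Section Reflection.
Context {F : fieldType}.
Implicit Types (f : {poly F}) (k : int) (c d : F).

(** f(c - w), the reflection of f about c / 2 *)
Definition reflp c f : {poly F} := f \Po (- 'X + c%:P).

Lemma reflpK c : involutive (reflp c).
Proof.
move=> f; rewrite /reflp -comp_polyA comp_polyD raddfN /= comp_polyX comp_polyC.
by rewrite opprD opprK addrNK comp_polyXr.
Qed.

Lemma reflpZ c d f : reflp c (d *: f) = d *: reflp c f.
Proof. by rewrite /reflp linearZ. Qed.

Lemma signzM k : (-1) ^ k * (-1) ^ k = 1 :> F.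
Proof. by rewrite -expfzMl mulrNN mulr1 exp1rz. Qed.

Lemma signz_parity k : - (-1) ^ k = (-1) ^+ parity_bar k :> F.
Proof.
have -> : (-1) ^ k = (-1) ^+ `|k|%N :> F.
  by case: k => n //; rewrite /exprz -exprVn invrN1.
by rewrite /parity_bar -signr_odd; case: odd; rewrite ?expr1 ?expr0 ?opprK.
Qed.

Lemma comp_shiftK c :
  cancel (fun f => f \Po ('X + c%:P)) (fun f => f \Po ('X - c%:P)).
Proof.
move=> f; rewrite -comp_polyA comp_polyD comp_polyX comp_polyC subrK.
exact: comp_polyXr.
Qed.

Lemma comp_shiftNK c :
  cancel (fun f => f \Po ('X - c%:P)) (fun f => f \Po ('X + c%:P)).
Proof.
move=> f; rewrite -comp_polyA comp_polyB comp_polyX comp_polyC addrK.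
exact: comp_polyXr.
Qed.

(** The reflection w |-> - 2 c - w fixes the point - c, which the translation
    w |-> w + c takes to the origin; it therefore acts on translates f(w + c)
    as w |-> - w acts on f. *)
Lemma reflp_parity k c d f : d = - c - c ->
  (-1) ^ k *: reflp d (f \Po ('X + c%:P)) = - (f \Po ('X + c%:P)) <->
  poly_parity (parity_bar k) f.
Proof.
move=> ->.
have -> : reflp (- c - c) (f \Po ('X + c%:P)) = (f \Po - 'X) \Po ('X + c%:P).
  rewrite /reflp -!comp_polyA; congr (_ \Po _).
  rewrite comp_polyD raddfN /= !comp_polyX comp_polyC opprD polyCB polyCN.
  by rewrite -!addrA addNr addr0.
rewrite -comp_polyZ -raddfN /= /poly_parity /= -signz_parity.
split=> [/(can_inj (comp_shiftK c)) E|->].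
  by rewrite scaleNr -scalerN -E scalerA signzM scale1r.
by rewrite scalerA mulrN signzM scaleN1r.
Qed.

End Reflection.

(** * Block form of expressions in the generators *)

Section NormalForms.
Context {F : fieldType}.
Implicit Types (f p : {poly F}) (k : int) (c d : F).

Lemma horner_alg_dmono0 p f :
  horner_alg ((dmono 0 p)%:M : SD F) f = (dmono 0 (f \Po p))%:M.
Proof.
elim/poly_ind: f => [|f c IHf].
  by rewrite rmorph0 comp_poly0 dmono0 raddf0.
rewrite comp_polyD comp_polyM comp_polyX comp_polyC.
rewrite rmorphD rmorphM /= horner_algX horner_algC IHf SD_scalarM diffopMUU.
by rewrite shiftp0 addr0 dmonoD raddfD /= SD1E SD_scalarZ diffopZU alg_polyC.
Qed.

Lemma SDDshiftE c : SDD + c%:A = (dmono 0 ('X + c%:P))%:M :> SD F.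
Proof. by rewrite SD1E SD_scalarZ diffopZU alg_polyC dmonoD raddfD. Qed.

Lemma SDDreflE c : - SDD + c%:A = (dmono 0 (- 'X + c%:P))%:M :> SD F.
Proof.
by rewrite SD1E SD_scalarZ diffopZU alg_polyC dmonoD raddfD !raddfN.
Qed.

Lemma SDNtzE k : (- SDt) ^ k = (dmono k ((-1) ^ k)%:P)%:M :> SD F.
Proof.
have E n (x : SD F) : (- x) ^+ n = (-1 : F) ^+ n *: x ^+ n.
  rewrite exprNn -signr_odd mulr_sign -(signr_odd F).
  by case: (odd n); rewrite ?expr1 ?expr0 ?scaleN1r ?scale1r.
have -> : (- SDt) ^ k = (-1 : F) ^ k *: SDt ^ k :> SD F.
  case: k => n; rewrite /exprz; first exact: E.
  by rewrite -!exprVn (invrN SDt) E (invrN 1) invr1.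
by rewrite SDtzE SD_scalarZ diffopZU alg_polyC.
Qed.

Lemma SDblock_horner_even i k c f :
  SDfermion F i i * SDt ^ k * horner_alg (SDD + c%:A) f =
  SDblock i i k (f \Po ('X + c%:P)).
Proof.
rewrite SDfermionE SDtzE SDDshiftE horner_alg_dmono0.
rewrite -[_ * (dmono k 1)%:M]/(SDblock i i k 1).
by rewrite SDblock_mulr shiftp1 mul1r addr0.
Qed.

Lemma SDblock_horner_theta k f :
  SDtheta * SDt ^ k * horner_alg SDD f = SDblock 1 0 k f.
Proof. by rewrite -mulrA SDmonomialE. Qed.

Lemma SDblock_horner_dtheta k d c f :
  SDdtheta * (- SDt) ^ k * d%:A * horner_alg (- SDD + c%:A) f =
  SDblock 0 1 k (((-1) ^ k * d) *: reflp c f).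
Proof.
rewrite SDDreflE horner_alg_dmono0 SDNtzE.
rewrite -[SDdtheta * _]/(SDblock 0 1 k ((-1) ^ k)%:P) -scalerAr mulr1 -SDblockZ.
by rewrite SDblock_mulr addr0 shiftp0 -scalerAl mul_polyC scalerA mulrC.
Qed.

End NormalForms.

(** * Degrees of blocks *)

(** Stated for an arbitrary grading group: the parity grading is needed for
    the signs in sigma, the principal one for the degrees. *)
Section Graded.
Context {F : fieldType} {G : zmodType} (wt : SDgen -> G).
Context (wtV : wt gen_tV = - wt gen_t) (wtD : wt gen_D = 0).

Lemma graded_dmono k f : graded wt (wt gen_t *~ k) ((dmono k f)%:M : SD F).
Proof.
have gX g (x : SD F) n : graded wt g x -> graded wt (g *+ n) (x ^+ n).
  move=> gx; elim: n => [|n IHn].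
    by rewrite mulr0n expr0; exact: graded1.
  by rewrite mulrS exprS; apply: gradedM.
have gt : graded wt (wt gen_t *~ k) (SDt ^ k : SD F).
  case: k => n; first exact/gX/(graded_gen F wt gen_t).
  rewrite /exprz -exprVn.
  have -> : wt gen_t *~ Negz n = wt gen_tV *+ n.+1 by rewrite wtV mulNrn.
  exact/gX/(graded_gen F wt gen_tV).
have gD : graded wt 0 (horner_alg (SDD : SD F) f).
  elim/poly_ind: f => [|f c IHf]; first by rewrite rmorph0; exact: graded0.
  rewrite rmorphD rmorphM /= horner_algX horner_algC; apply: gradedD.
    rewrite -[0]addr0; apply: gradedM => //.
    by rewrite -wtD; exact: (graded_gen F wt gen_D).
  exact/gradedZ/graded1.
by rewrite -SDmonomialE -[_ *~ _]addr0; apply: gradedM.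
Qed.

Lemma graded_block_odd i j k f : i != j ->
  graded wt (wt (if i == 0 then gen_dtheta else gen_theta) + wt gen_t *~ k)
    (SDblock i j k f : SD F).
Proof.
move=> ne; apply: gradedM (graded_dmono _ _).
have := graded_gen F wt (if i == 0 then gen_dtheta else gen_theta).
by move: ne; elim/ord2_ind: i; elim/ord2_ind: j.
Qed.

Lemma graded_block_even i k f :
  wt gen_dtheta = - wt gen_theta ->
  graded wt (wt gen_t *~ k) (SDblock i i k f : SD F).
Proof.
move=> wtN; rewrite -[_ *~ _]add0r; apply: gradedM (graded_dmono _ _).
have gth := graded_gen F wt gen_theta.
have gdth := graded_gen F wt gen_dtheta.
elim/ord2_ind: i; rewrite -SDfermionE /SDfermion /=.
  by rewrite -(addNr (wt gen_theta)) -wtN; apply: gradedM.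
by rewrite -(addrN (wt gen_theta)) -wtN; apply: gradedM.
Qed.

End Graded.

Section PrincipalShape.
Context {F : fieldType}.
Implicit Types (f g : {poly F}) (k j : int) (X : SD F) (m : rat) (i : 'I_2).

Lemma graded_principal_dmono m X i i' k :
  graded SDprincipal m X -> m - ((i : nat)%:R - (i' : nat)%:R) / 2 = k%:~R ->
  exists f, X i i' = dmono k f.
Proof.
move=> /graded_principal - /(_ i i') [->|[k' [f [-> ->]]]].
  by exists 0; rewrite dmono0.
by move=> /intr_inj <-; exists f.
Qed.

Lemma graded_principal_eq0 m X i i' :
  graded SDprincipal m X ->
  (forall k : int, m - ((i : nat)%:R - (i' : nat)%:R) / 2 <> k%:~R) ->
  X i i' = 0.
Proof. by move=> /graded_principal - /(_ i i') [//|[k [f [_ E]]]] /(_ k). Qed.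

Lemma half_not_int j k : (j%:~R - 1 / 2 : rat) <> k%:~R.
Proof.
move=> E; have : (2 * j - 1)%:~R = (2 * k)%:~R :> rat.
  by rewrite intrB !intrM -E; field.
by move=> /intr_inj; lia.
Qed.

Let val_ord1 : nat_of_ord (1 : 'I_2) = 1%N. Proof. by []. Qed.

Lemma graded_principal_intP j X :
  graded SDprincipal j%:~R X <->
  exists f g, X = SDblock 0 0 j f + SDblock 1 1 j g.
Proof.
split=> [gX|[f [g ->]]]; last first.
  by apply: gradedD; apply: (graded_block_even (wt := SDprincipal)).
have [|f Ef] := @graded_principal_dmono _ _ 0 0 j gX.
  by rewrite subrr mul0r subr0.
have [|g Eg] := @graded_principal_dmono _ _ 1 1 j gX.
  by rewrite subrr mul0r subr0.
have E10 : X 1 0 = 0.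
  by apply: (graded_principal_eq0 gX) => k; rewrite subr0; exact: half_not_int.
have E01 : X 0 1 = 0.
  apply: (graded_principal_eq0 gX) => k E; apply: (@half_not_int (j + 1) k).
  by rewrite -E intrD val_ord1 /=; field.
exists f, g; apply/matrixP => i i'; rewrite mxE !SDblockE.
by elim/ord2_ind: i; elim/ord2_ind: i';
  rewrite /= ?Ef ?Eg ?E10 ?E01 ?addr0 ?add0r.
Qed.

Lemma graded_principal_halfP j X :
  graded SDprincipal (j%:~R - 1 / 2) X <->
  exists f g, X = SDblock 1 0 (j - 1) f + SDblock 0 1 j g.
Proof.
split=> [gX|[f [g ->]]].
  have [|f Ef] := @graded_principal_dmono _ _ 1 0 (j - 1) gX.
    by rewrite intrB val_ord1 /=; field.
  have [|g Eg] := @graded_principal_dmono _ _ 0 1 j gX.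
    by rewrite val_ord1 /=; field.
  have E0 i : X i i = 0.
    apply: (graded_principal_eq0 gX) => k; rewrite subrr mul0r subr0.
    exact: half_not_int.
  exists f, g; apply/matrixP => i i'; rewrite mxE !SDblockE.
  by elim/ord2_ind: i; elim/ord2_ind: i';
    rewrite /= ?Ef ?Eg ?E0 ?addr0 ?add0r.
apply: gradedD.
  have -> : j%:~R - 1 / 2 =
      SDprincipal gen_theta + SDprincipal gen_t *~ (j - 1).
    by rewrite /= intrB; field.
  exact: (@graded_block_odd F _ SDprincipal erefl erefl 1 0 (j - 1) f erefl).
have -> : j%:~R - 1 / 2 = SDprincipal gen_dtheta + SDprincipal gen_t *~ j.
  by rewrite /=; field.
exact: (@graded_block_odd F _ SDprincipal erefl erefl 0 1 j g erefl).
Qed.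

End PrincipalShape.

(** * The action of sigma on blocks *)

Section Sigma.
Context {F : fieldType} (a b : F) (b_neq0 : b != 0).
Context (s : {linear SD F -> SD F}) (sP : is_sigma a b s).
Implicit Types (f g : {poly F}) (k m : int) (X Y : SD F) (c : F).

Lemma parity_dmono k f : graded SDparity false ((dmono k f)%:M : SD F).
Proof.
have := @graded_dmono F _ SDparity erefl erefl k f.
by rewrite (mul0rz (_ : zmodType)).
Qed.

Lemma sigma_evenM (q : bool) X Y :
  graded SDparity false X -> graded SDparity q Y -> s (X * Y) = s Y * s X.
Proof. by move=> gX gY; rewrite (sigma_anti sP gX gY) expr0 scale1r. Qed.

(** An anti-morphism satisfies s 1 * s t = s t, and s t = - t is a unit. *)
Lemma sigma1 : s 1 = 1.
Proof.
have tU : - SDt \is a @GRing.unit (SD F) by rewrite unitrN SDt_unit.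
apply: (mulrI tU); rewrite mulr1 -(sigma_t sP) -(@sigma_evenM false) ?mul1r //.
  exact: graded1.
exact: parity_dmono.
Qed.

Lemma sigma_evenX X n : graded SDparity false X -> s (X ^+ n) = s X ^+ n.
Proof.
move=> gX; have gXn (r : nat) : graded SDparity false (X ^+ r).
  elim: r => [|r IHr]; first exact: graded1.
  by rewrite exprS -[false]/(false + false)%R; apply: gradedM.
elim: n => [|n IHn]; first by rewrite !expr0 sigma1.
by rewrite exprS (@sigma_evenM false) // IHn exprSr.
Qed.

Lemma sigma_tz k : s (SDt ^ k) = (- SDt) ^ k.
Proof.
have gt : graded SDparity false (SDt : SD F) by exact: parity_dmono.
case: k => n; first by rewrite /exprz sigma_evenX // (sigma_t sP).
have gtV : graded SDparity false (SDt^-1 : SD F).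
  exact: (graded_gen F SDparity gen_tV).
have tU : - SDt \is a @GRing.unit (SD F) by rewrite unitrN SDt_unit.
rewrite /exprz -!exprVn sigma_evenX //; congr (_ ^+ _).
apply: (mulIr tU); rewrite mulVr // -(sigma_t sP) -(@sigma_evenM false) //.
by rewrite mulrV ?SDt_unit // sigma1.
Qed.

Lemma sigma_D_delta i j :
  s SDD * delta_mx i j =
  delta_mx i j * (dmono 0 (- 'X + (a + (i == 0)%:R)%:P))%:M.
Proof.
rewrite (sigma_D sP) mulrDl SDDreflE SD_comm_delta.
have -> : SDdtheta * SDtheta * delta_mx i j =
    delta_mx i j * (dmono 0 (i == 0)%:R%:P)%:M :> SD F.
  rewrite -[_ * SDtheta]/(SDfermion F 0 0) SDfermionE.
  rewrite -[LHS]/(delta_mx 0 0 *m delta_mx i j) mul_delta_mx_cond.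
  rewrite eq_sym; elim/ord2_ind: i; rewrite /= ?dmono0 ?raddf0 ?mulr0 //.
  by rewrite -SD1E mulr1.
by rewrite -mulrDr -raddfD -dmonoD -addrA -polyCD.
Qed.

Lemma sigma_polyD_delta f i j :
  s (dmono 0 f)%:M * delta_mx i j = SDblock i j 0 (reflp (a + (i == 0)%:R) f).
Proof.
rewrite /reflp; elim/poly_ind: f => [|f c IHf].
  by rewrite dmono0 raddf0 raddf0 mul0r comp_poly0 SDblock0.
have -> : (dmono 0 (f * 'X + c%:P))%:M = (dmono 0 f)%:M * SDD + c *: (1 : SD F).
  by rewrite SD_scalarM diffopMUU shiftp0 addr0 SD1E SD_scalarZ diffopZU
    alg_polyC dmonoD raddfD.
rewrite linearD linearZ /= sigma1 (@sigma_evenM false); last 2 first.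
- exact: parity_dmono.
- exact: parity_dmono.
rewrite mulrDl -mulrA IHf /SDblock mulrA sigma_D_delta -mulrA SD_scalarM.
rewrite diffopMUU shiftp0 addr0 -scalerAl mul1r.
rewrite comp_polyD comp_polyM comp_polyX comp_polyC.
rewrite -[RHS]/(SDblock i j 0 (_ + _)) SDblockD [in RHS]mulrC; congr (_ + _).
by rewrite -alg_polyC SDblockZ SDblock1.
Qed.

Lemma sigma_block i j k f :
  s (SDblock i j k f) =
  s (dmono 0 f)%:M * (dmono k ((-1) ^ k)%:P)%:M * s (delta_mx i j).
Proof.
have [q gp] : exists q : bool, graded SDparity q (delta_mx i j : SD F).
  have ev (l : 'I_2) : graded SDparity false (delta_mx l l : SD F).
    have := @graded_block_even F _ SDparity erefl erefl l 0 1 erefl.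
    by rewrite SDblock1.
  elim/ord2_ind: i; elim/ord2_ind: j.
  - by exists false.
  - by exists true; exact: (graded_gen F SDparity gen_dtheta).
  - by exists true; exact: (graded_gen F SDparity gen_theta).
  - by exists false.
rewrite /SDblock (sigma_anti sP gp (parity_dmono _ _)) andbF expr0 scale1r.
congr (_ * _).
have -> : (dmono k f)%:M = SDt ^ k * (dmono 0 f)%:M :> SD F.
  by rewrite -SDD_horner SDmonomialE.
rewrite (@sigma_evenM false) ?sigma_tz ?SDNtzE // ?SDtzE; exact: parity_dmono.
Qed.

(** The reflection constant collects two shifts: sigma(D) acts on E_i'j' as
    - D + a + (i' == 0), and carrying a polynomial in D past t^(k+m) replaces
    D by D + k + m. *)
Lemma sigma_block_gen i j k f i' j' m c :
  s (delta_mx i j) = SDblock i' j' m c%:P ->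
  s (SDblock i j k f) =
  SDblock i' j' (k + m)
    ((-1) ^ k * c *: reflp (a + (i' == 0)%:R - (k + m)%:~R) f).
Proof.
move=> E; rewrite sigma_block E [in LHS]/SDblock.
rewrite mulrA -(mulrA (s _)) SD_comm_delta mulrA sigma_polyD_delta -mulrA.
rewrite SD_scalarM diffopMUU SDblock_mulr add0r; congr SDblock.
rewrite {1}/shiftp /reflp -comp_polyA /shiftp comp_polyC -polyCM mulrC.
rewrite mul_polyC comp_polyD raddfN /= comp_polyX comp_polyC opprD -addrA.
by rewrite [(a + _ - _)%:P]polyCB [- _ + (_)%:P]addrC.
Qed.

Lemma sigma_delta10 : s (delta_mx 1 0) = SDblock 0 1 1 b%:P.
Proof.
rewrite -[delta_mx 1 0]/SDtheta (sigma_theta sP) -scalerAl.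
by rewrite -[b%:P]alg_polyC SDblockZ /SDblock -SD_comm_delta.
Qed.

Lemma sigma_delta01 : s (delta_mx 0 1) = SDblock 1 0 (-1) (- b^-1)%:P.
Proof.
rewrite -[delta_mx 0 1]/SDdtheta (sigma_dtheta sP).
rewrite invrZ ?unitfE // ?SDt_unit // SDtVE mulNr -scalerAl.
by rewrite -[(- b^-1)%:P]alg_polyC SDblockZ /SDblock -SD_comm_delta scaleNr.
Qed.

Lemma sigma_delta00 : s (delta_mx 0 0) = SDblock 0 0 0 1%:P.
Proof.
have -> : delta_mx 0 0 = SDdtheta * SDtheta :> SD F.
  by rewrite -[RHS]/(SDfermion F 0 0) SDfermionE.
rewrite (sigma_anti sP (graded_gen F SDparity gen_dtheta)
  (graded_gen F SDparity gen_theta)).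
rewrite expr1 scaleN1r /= sigma_delta10 sigma_delta01 SDblockM addrN.
rewrite /shiftp comp_polyC.
by rewrite -polyCM mulrN mulfV // polyCN SDblockN opprK.
Qed.

Lemma sigma_delta11 : s (delta_mx 1 1) = SDblock 1 1 0 1%:P.
Proof.
have -> : delta_mx 1 1 = SDtheta * SDdtheta :> SD F.
  by rewrite -[RHS]/(SDfermion F 1 1) SDfermionE.
rewrite (sigma_anti sP (graded_gen F SDparity gen_theta)
  (graded_gen F SDparity gen_dtheta)).
rewrite expr1 scaleN1r /= sigma_delta10 sigma_delta01 SDblockM addNr.
rewrite /shiftp comp_polyC.
by rewrite -polyCM mulNr mulVf // polyCN SDblockN opprK.
Qed.

Lemma sigma_block00 k f :
  s (SDblock 0 0 k f) =
  SDblock 0 0 k ((-1) ^ k *: reflp (a + 1 - k%:~R) f).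
Proof. by rewrite (sigma_block_gen _ _ sigma_delta00) addr0 mulr1. Qed.

Lemma sigma_block11 k f :
  s (SDblock 1 1 k f) = SDblock 1 1 k ((-1) ^ k *: reflp (a - k%:~R) f).
Proof. by rewrite (sigma_block_gen _ _ sigma_delta11) !addr0 mulr1. Qed.

Lemma sigma_block10 k f :
  s (SDblock 1 0 (k - 1) f) =
  SDblock 0 1 k (- ((-1) ^ k * b) *: reflp (a + 1 - k%:~R) f).
Proof.
rewrite (sigma_block_gen _ _ sigma_delta10) subrK; congr SDblock.
by rewrite expfzDr ?oppr_eq0 ?oner_eq0 // exprN1 invrN1 mulrN1 mulNr.
Qed.

Lemma sigma_block01 k f :
  s (SDblock 0 1 k f) =
  SDblock 1 0 (k - 1) (- ((-1) ^ k * b^-1) *: reflp (a + 1 - k%:~R) f).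
Proof.
rewrite (sigma_block_gen _ _ sigma_delta01) mulrN.
have -> : a + (1%R == 0 :> 'I_2)%:R - (k + -1)%:~R = a + 1 - k%:~R.
  by rewrite addr0 intrB opprB addrA.
by [].
Qed.

Lemma SDsigma_evenP k f g :
  s (SDblock 0 0 k f + SDblock 1 1 k g) =
    - (SDblock 0 0 k f + SDblock 1 1 k g) <->
  (-1) ^ k *: reflp (a + 1 - k%:~R) f = - f /\
  (-1) ^ k *: reflp (a - k%:~R) g = - g.
Proof.
rewrite linearD /= sigma_block00 sigma_block11 opprD -!SDblockN.
split=> [|[-> ->] //].
exact: SDblock_pair_inj.
Qed.

(** Of the two component equations, the one on E_01 already determines g;
    the one on E_10 is its image under sigma, an involution on these
    blocks. *)
Lemma SDsigma_oddP k f g :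
  s (SDblock 1 0 (k - 1) f + SDblock 0 1 k g) =
    - (SDblock 1 0 (k - 1) f + SDblock 0 1 k g) <->
  g = ((-1) ^ k * b) *: reflp (a + 1 - k%:~R) f.
Proof.
rewrite linearD /= sigma_block10 sigma_block01 opprD addrC -!SDblockN.
split=> [/SDblock_pair_inj [] // _ /eqP|->].
  by rewrite scaleNr eqr_opp => /eqP <-.
rewrite reflpZ reflpK scalerA scaleNr mulNr.
have -> : (-1) ^ k * b^-1 * ((-1) ^ k * b) = 1.
  by rewrite mulrACA mulVf // signzM mulr1.
by rewrite scaleN1r.
Qed.

(** * Graded components of the -1 eigenspace of sigma *)

Lemma SDsigma_deg_int (j : int) : (2 : F) != 0 ->
  SDsigma_deg s j%:~R =
    [set SDblock 0 0 j (f \Po ('X + ((j%:~R - a - 1) / 2)%:P))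
         + SDblock 1 1 j (g \Po ('X + ((j%:~R - a) / 2)%:P))
      | f in @poly_parity F (parity_bar j)
      & g in @poly_parity F (parity_bar j)].
Proof.
move=> two.
have par0 f : (-1) ^ j *: reflp (a + 1 - j%:~R)
      (f \Po ('X + ((j%:~R - a - 1) / 2)%:P)) =
    - (f \Po ('X + ((j%:~R - a - 1) / 2)%:P)) <-> poly_parity (parity_bar j) f.
  by apply: reflp_parity; field.
have par1 f : (-1) ^ j *: reflp (a - j%:~R)
      (f \Po ('X + ((j%:~R - a) / 2)%:P)) =
    - (f \Po ('X + ((j%:~R - a) / 2)%:P)) <-> poly_parity (parity_bar j) f.
  by apply: reflp_parity; field.
apply/seteqP; split=> X.
- move=> [sX /graded_principal_intP [f [g EX]]]; move: sX.
  rewrite /SDsigma /= EX -(comp_shiftNK ((j%:~R - a - 1) / 2) f).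
  rewrite -(comp_shiftNK ((j%:~R - a) / 2) g).
  move=> /SDsigma_evenP [/par0 pf /par1 pg].
  by exists (f \Po ('X - ((j%:~R - a - 1) / 2)%:P)) => //;
    exists (g \Po ('X - ((j%:~R - a) / 2)%:P)).
- move=> /= [f pf [g pg <-]]; split.
    by apply/SDsigma_evenP; split; [apply/par0|apply/par1].
  apply/graded_principal_intP.
  by exists (f \Po ('X + ((j%:~R - a - 1) / 2)%:P)),
    (g \Po ('X + ((j%:~R - a) / 2)%:P)).
Qed.

Lemma SDsigma_deg_half (j : int) :
  SDsigma_deg s (j%:~R - 1 / 2) =
    [set SDblock 1 0 (j - 1) g0
         + SDblock 0 1 j (((-1) ^ j * b) *: reflp (a + 1 - j%:~R) g0)
      | g0 in [set: {poly F}]].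
Proof.
apply/seteqP; split=> X.
- move=> [sX /graded_principal_halfP [f [g EX]]]; move: sX.
  by rewrite /SDsigma /= EX => /SDsigma_oddP ->; exists f.
- move=> /= [f _ <-]; split; first exact/SDsigma_oddP.
  apply/graded_principal_halfP.
  by exists f, (((-1) ^ j * b) *: reflp (a + 1 - j%:~R) f).
Qed.

End Sigma.

Theorem proposition4p1 (R : realType) (a b : R[i]) (b_neq0 : b != 0) (j : int)
    (sigma : {linear SD R[i] -> SD R[i]}) (sigmaP : is_sigma a b sigma) :
  SDsigma_deg sigma j%:~R =
    [set SDdtheta * SDtheta * SDt ^ j
           * horner_alg (SDD + ((j%:~R - a - 1) / 2)%:A) f
         + SDtheta * SDdtheta * SDt ^ j
           * horner_alg (SDD + ((j%:~R - a) / 2)%:A) g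
      | f in @poly_parity R[i] (parity_bar j)
      & g in @poly_parity R[i] (parity_bar j)]
  /\
  SDsigma_deg sigma (j%:~R - 1 / 2) =
    [set SDtheta * SDt ^ (j - 1) * horner_alg SDD g0
         + SDdtheta * (- SDt) ^ j * b%:A
           * horner_alg (- SDD + (- j%:~R + a + 1)%:A) g0
      | g0 in [set: {poly R[i]}]].
Proof.
split.
  rewrite (SDsigma_deg_int b_neq0 sigmaP); last by rewrite pnatr_eq0.
  congr image2; apply/funext => f; apply/funext => g.
  by rewrite -(SDblock_horner_even 0) -(SDblock_horner_even 1).
rewrite (SDsigma_deg_half b_neq0 sigmaP).
congr image; apply/funext => g.
have cE : - j%:~R + a + 1 = a + 1 - j%:~R by rewrite -addrA addrC.
by rewrite SDblock_horner_theta SDblock_horner_dtheta cE.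
Qed.
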